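(* Let $P$ be a combinatorial specification involving exactly the combinatorial sets $\mathcal{B}^{(1)},\ldots,\mathcal{B}^{(N)}$, each of which is the left-hand side of exactly one rule of $P$, the rules being $\mathcal{B}^{(j)} \xleftarrow{S_j} (\mathcal{B}^{(i_{j,1})},\ldots,\mathcal{B}^{(i_{j,m_j})})$ for $1\le j\le N$. Let $\mathscr{S}(P)$ be the infinite system of equations in the indeterminates $\{b^{(i)}_k : k\in\mathbb{N},\ 1\le i\le N\}$ consisting, for every $1\le j\le N$ and every $n\in\mathbb{N}$, of the equation $$b^{(j)}_n = c_{S_j,(n)}\Big(\big(b^{(i_{j,1})}_0,\ldots,b^{(i_{j,1})}_{r^{(1)}_{S_j}(n)}\big),\ldots,\big(b^{(i_{j,m_j})}_0,\ldots,b^{(i_{j,m_j})}_{r^{(m_j)}_{S_j}(n)}\big)\Big).$$ Suppose the reliance graph of $P$ contains no infinite directed walk. Then $\mathscr{S}(P)$ has a unique solution in $(\mathbb{C}^{\mathbb{N}})^N$; that is, $P$ is productive.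
   Context: A combinatorial set is a set of objects each with a size in $\mathbb{N}$, finitely many of each size; $\mathcal{A}_n$ denotes its objects of size $n$. An $m$-ary combinatorial strategy $S$ ($m\ge0$) consists of: (1) a decomposition function $d_S$ sending each combinatorial set either to an $m$-tuple of combinatorial sets or to the symbol DNA; (2) a reliance profile function $r_S:\mathbb{N}\to\mathbb{Z}^m$, $r_S(n)=(r^{(1)}_S(n),\ldots,r^{(m)}_S(n))$; (3) counting functions $c_{S,(n)}$, $n\in\mathbb{N}$, each taking $m$ tuples, the $k$-th of length $\max(0,r^{(k)}_S(n)+1)$, such that whenever $d_S(\mathcal{A})=(\mathcal{B}^{(1)},\ldots,\mathcal{B}^{(m)})$ we have $c_{S,(n)}(w^{(1)},\ldots,w^{(m)})=|\mathcal{A}_n|$ for $w^{(i)}=(|\mathcal{B}^{(i)}_0|,\ldots,|\mathcal{B}^{(i)}_{r^{(i)}_S(n)}|)$. When $d_S(\mathcal{A})=(\mathcal{B}^{(1)},\ldots,\mathcal{B}^{(m)})$ one has the combinatorial rule $\mathcal{A}\xleftarrow{S}(\mathcal{B}^{(1)},\ldots,\mathcal{B}^{(m)})$. A combinatorial specification is a set of rules such that every set on a right-hand side is the left-hand side of exactly one rule. (For $m_j=0$ the equation's right-hand side is a constant.) The reliance graph of $P$ is the directed graph with vertex set $\{\mathcal{B}^{(i)}_k : 1\le i\le N,\ k\in\mathbb{N}\}$ and a directed edge from $\mathcal{B}^{(j)}_n$ to $\mathcal{B}^{(i_{j,\ell})}_k$ for every $1\le\ell\le m_j$ and every $0\le k\le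 r^{(\ell)}_{S_j}(n)$. A specification is called productive if the system $\mathscr{S}(P)$ has a unique solution in $(\mathbb{C}^{\mathbb{N}})^N$. *)

(* Defs.v *)
From HB Require Import structures.
From mathcomp Require Import all_boot all_order all_algebra.
From mathcomp Require Import boolp classical_sets functions cardinality reals.
From mathcomp Require Import complex.

Set Implicit Arguments.
Unset Strict Implicit.
Unset Printing Implicit Defensive.

Import Order.TTheory GRing.Theory Num.Theory.

Local Open Scope classical_set_scope.
Local Open Scope card_scope.
Local Open Scope ring_scope.

Record combset := Combset {
  obj : Type;
  objsize : obj -> nat;
  objsize_fin : forall n, finite_set [set x | objsize x = n]
}.

Definition objs_of_size (A : combset) (n : nat) : set (obj A) :=
  [set x | objsize x = n].
Arguments objs_of_size : clear implicits.

(* [finite_set X] unfolds to [exists k, X #= `I_k]; this is that k. *)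
Definition card_of_size (A : combset) (n : nat) : nat :=
  projT1 (cid (objsize_fin A n)).

Lemma card_of_sizeP (A : combset) (n : nat) :
  objs_of_size A n #= `I_(card_of_size A n).
Proof. exact: (projT2 (cid (objsize_fin A n))). Qed.

(* max(0, r + 1), the length of the tuple (b_0, ..., b_r). *)
Definition rlen (r : int) : nat := absz (Num.max 0 (r + 1)).

Definition initial_terms (T : Type) (b : nat -> T) (r : int) :
  (rlen r).-tuple T := [tuple b k | k < rlen r].

(* DNA ("does not apply") is [None]. *)
Record strategy (R : realType) := Strategy {
  arity : nat;
  decomp : combset -> option (arity.-tuple combset);
  reliance : nat -> arity.-tuple int;
  counting : forall n : nat,
    (forall k : 'I_arity, (rlen (tnth (reliance n) k)).-tuple R[i]) -> R[i];
  countingP : forall (A : combset) (Bs : arity.-tuple combset),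
    decomp A = Some Bs ->
    forall n : nat,
      counting (fun k : 'I_arity =>
        initial_terms (fun s => (card_of_size (tnth Bs k) s)%:R)
          (tnth (reliance n) k)) = (card_of_size A n)%:R
}.
Arguments counting {R} s n _.

Record rule (R : realType) := Rule {
  lhs : combset;
  strat : strategy R;
  rhs : (arity strat).-tuple combset
}.

Definition valid_rule (R : realType) (r : rule R) : Prop :=
  decomp (strat r) (lhs r) = Some (rhs r).

Definition specification (R : realType) (P : set (rule R)) : Prop :=
  (forall r, P r -> valid_rule r) /\
  (forall r, P r -> forall k : 'I_(arity (strat r)),
     exists! r', P r' /\ lhs r' = tnth (rhs r) k).

Definition involved (R : realType) (P : set (rule R)) : set combset :=
  [set A | exists r, P r /\
     (A = lhs r \/ exists k : 'I_(arity (strat r)), A = tnth (rhs r) k)].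

(* From here on the rules are B_j <-(S j)- (B_(idx j 1), ..., B_(idx j m_j)),
   j < N. The system and the reliance graph depend only on S and idx; the vertex
   (j, n) stands for the objects of size n of B_j. *)
Definition solution (R : realType) (N : nat) (S : 'I_N -> strategy R)
    (idx : forall j : 'I_N, (arity (S j)).-tuple 'I_N)
    (b : 'I_N -> nat -> R[i]) : Prop :=
  forall (j : 'I_N) (n : nat),
    b j n = counting (S j) n (fun l : 'I_(arity (S j)) =>
      initial_terms (b (tnth (idx j) l)) (tnth (reliance (S j) n) l)).
Arguments solution {R N} S idx b.

Definition productive (R : realType) (N : nat) (S : 'I_N -> strategy R)
    (idx : forall j : 'I_N, (arity (S j)).-tuple 'I_N) : Prop :=
  exists! b : 'I_N -> nat -> R[i], solution S idx b.
Arguments productive {R N} S idx.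

Definition reliance_edge (R : realType) (N : nat) (S : 'I_N -> strategy R)
    (idx : forall j : 'I_N, (arity (S j)).-tuple 'I_N)
    (u v : 'I_N * nat) : Prop :=
  exists l : 'I_(arity (S u.1)),
    v.1 = tnth (idx u.1) l /\ v.2%:Z <= tnth (reliance (S u.1) u.2) l.
Arguments reliance_edge {R N} S idx u v.

Definition infinite_walk (V : Type) (e : V -> V -> Prop) (w : nat -> V) : Prop :=
  forall t : nat, e (w t) (w t.+1).

(* Main.v *)
(* The cardinalities of the sets solve the system, because each rule is valid.
   For uniqueness, the absence of infinite walks makes the reliance relation
   well-founded, and two solutions agree at a vertex as soon as they agree at
   all vertices it relies on. *)

Require Import Defs.
From HB Require Import structures.
From mathcomp Require Import all_boot all_order all_algebra.
From mathcomp Require Import boolp classical_sets functions cardinality reals.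
From mathcomp Require Import complex.

Set Implicit Arguments.
Unset Strict Implicit.
Unset Printing Implicit Defensive.

Import Order.TTheory GRing.Theory Num.Theory.

Local Open Scope classical_set_scope.
Local Open Scope ring_scope.

Lemma no_infinite_walk_ind (V : Type) (e : V -> V -> Prop) (Q : V -> Prop) :
  ~ (exists w : nat -> V, infinite_walk e w) ->
  (forall u, (forall v, e u v -> Q v) -> Q u) -> forall u, Q u.
Proof.
move=> nowalk IH u; apply: contrapT => nQu; apply: nowalk.
have step (x : {v | ~ Q v}) : {y : {v | ~ Q v} | e (sval x) (sval y)}.
  apply: cid; case: x => x nQx /=; apply: contrapT => noedge.
  apply: nQx; apply: IH => v exv; apply: contrapT => nQv.
  by apply: noedge; exists (exist _ v nQv).
exists (fun t => sval (iter t (fun x => sval (step x)) (exist _ u nQu))) => t.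
by rewrite iterS; apply: (svalP (step _)).
Qed.

Lemma ltn_rlen (k : nat) (r : int) : (k < rlen r)%N -> k%:Z <= r.
Proof.
rewrite /rlen -ltz_nat gez0_abs ?le_max ?lexx // lt_max.
by rewrite ltz_nat ltn0 /= ltzD1.
Qed.

Lemma eq_initial_terms (T : Type) (b b' : nat -> T) (r : int) :
  (forall k : nat, k%:Z <= r -> b k = b' k) ->
  initial_terms b r = initial_terms b' r.
Proof.
move=> eqb; apply: eq_from_tnth => k; rewrite !tnth_mktuple.
exact/eqb/ltn_rlen/ltn_ord.
Qed.

Lemma card_of_size_solution (R : realType) (N : nat) (B : 'I_N -> combset)
    (S : 'I_N -> strategy R)
    (idx : forall j : 'I_N, (arity (S j)).-tuple 'I_N) :
  (forall j, valid_rule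
     (@Rule R (B j) (S j) [tuple B (tnth (idx j) l) | l < arity (S j)])) ->
  solution S idx (fun j n => (card_of_size (B j) n)%:R).
Proof.
move=> validB j n; rewrite -(countingP (validB j)); congr counting.
by apply: functional_extensionality_dep => l; rewrite tnth_mktuple.
Qed.

Lemma solution_unique (R : realType) (N : nat) (S : 'I_N -> strategy R)
    (idx : forall j : 'I_N, (arity (S j)).-tuple 'I_N)
    (b b' : 'I_N -> nat -> R[i]) :
  ~ (exists w, infinite_walk (reliance_edge S idx) w) ->
  solution S idx b -> solution S idx b' -> b = b'.
Proof.
move=> nowalk solb solb'; apply/funext => j; apply/funext => n.
pose agree (u : 'I_N * nat) := b u.1 u.2 = b' u.1 u.2.
apply: (no_infinite_walk_ind (Q := agree) nowalk _ (j, n)) => {j n} -[j n] IH.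
rewrite /agree /= solb solb'; congr counting.
apply: functional_extensionality_dep => l; apply: eq_initial_terms => k le_kr.
by apply: (IH (tnth (idx j) l, k)); exists l.
Qed.

Theorem theorem4p2 (R : realType) (P : set (rule R)) (N : nat)
    (B : 'I_N -> combset) (S : 'I_N -> strategy R)
    (idx : forall j : 'I_N, (arity (S j)).-tuple 'I_N)
    (hP : specification P)
    (hBinj : injective B)
    (hinv : involved P = range B)
    (hone : forall j : 'I_N, exists! r : rule R, P r /\ lhs r = B j)
    (hrules : forall j : 'I_N,
       P (@Rule R (B j) (S j) [tuple B (tnth (idx j) l) | l < arity (S j)]))
    (hwalk : ~ exists w : nat -> 'I_N * nat,
       infinite_walk (reliance_edge S idx) w) :
  productive S idx.
Proof.
exists (fun j n => (card_of_size (B j) n)%:R).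
have solB := card_of_size_solution (fun j => hP.1 _ (hrules j)).
by split=> // b solb; apply: solution_unique hwalk solB solb.
Qed.
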